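(* Let $s_i$ be independent random variables and let $\mathbf Z_i$ be fixed square rank-$1$ matrices (all of the same size). If $\widehat{\mathbf H}=\sum_i s_i\mathbf Z_i$ is invertible almost surely, then the inverse of the matrix $\mathbf H=\mathbb E[\widehat{\mathbf H}]$ can be expressed as $$\mathbf H^{-1}=\frac{\mathbb E\big[\det(\widehat{\mathbf H})\,\widehat{\mathbf H}^{-1}\big]}{\mathbb E\big[\det(\widehat{\mathbf H})\big]}.$$
   Context: The $s_i$ are scalar random variables, ''fixed'' means deterministic, the sum over $i$ is a finite sum, and expectations of random matrices are taken entrywise (the expectation $\mathbb E[\widehat{\mathbf H}]$ is presupposed to exist).
   Formalization: The invertibility of H = E[Ĥ] is assumed: almost sure invertibility of Ĥ does not imply it (for 1×1 matrices with Z = (1) and s = ±1 equally likely, H = 0 and E[det Ĥ] = 0). *)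

(* Defs.v *)
From HB Require Import structures.
From mathcomp Require Export all_boot all_order all_algebra.
From mathcomp Require Export all_classical all_reals all_analysis.
Set Implicit Arguments.
Unset Strict Implicit.
Unset Printing Implicit Defensive.
Import Order.TTheory GRing.Theory Num.Theory.
Import numFieldNormedType.Exports.
Local Open Scope classical_set_scope.
Local Open Scope ring_scope.

(* Mutual (not merely pairwise) independence: the product rule is required of
   every subfamily J of the finite family X. *)
Definition mutually_independent (d : measure_display) (T : measurableType d)
    (R : realType) (P : probability T R) (I : finType)
    (X : I -> {RV P >-> R}) : Prop :=
  forall (J : {set I}) (B : I -> set R),
    (forall i, i \in J -> measurable (B i)) ->
    P (\bigcap_(i in [set` J]) (X i @^-1` B i)) =
      (\prod_(i in J) P (X i @^-1` B i))%E.

Definition mx_integrable (d : measure_display) (T : measurableType d)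
    (R : realType) (P : probability T R) (m n : nat)
    (M : T -> 'M[R]_(m, n)) : Prop :=
  forall i j, P.-integrable [set: T] (fun w => (M w i j)%:E).

(* Entrywise; since `fine` sends infinite values to 0, this is the expectation
   only when mx_integrable P M. *)
Definition mx_expectation (d : measure_display) (T : measurableType d)
    (R : realType) (P : probability T R) (m n : nat)
    (M : T -> 'M[R]_(m, n)) : 'M[R]_(m, n) :=
  \matrix_(i < m, j < n) fine ('E_P[fun w => M w i j])%E.

Definition random_sum_mx (d : measure_display) (T : measurableType d)
    (R : realType) (P : probability T R) (I : finType) (n : nat)
    (s : I -> {RV P >-> R}) (Z : I -> 'M[R]_n) (w : T) : 'M[R]_n :=
  \sum_(i : I) s i w *: Z i.

(* Main.v *)
Require Import Defs.
From mathcomp Require Import all_boot all_order all_algebra.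
From mathcomp Require Import all_classical all_reals all_analysis.
From mathcomp Require Import perm measurable_realfun.
Set Implicit Arguments.
Unset Strict Implicit.
Unset Printing Implicit Defensive.
Import Order.TTheory GRing.Theory Num.Theory.
Import numFieldNormedType.Exports.
Local Open Scope classical_set_scope.
Local Open Scope ring_scope.

(* Writing Z_i = u_i v_i and expanding by multilinearity and alternation, the
   determinant and the cofactors of \sum_i x_i Z_i are multi-affine in x: every
   monomial \prod_k x_(f k) has f injective.  By independence, expectation
   commutes with multi-affine functions of the s_i, so E[det Hhat] = det H and
   E[adj Hhat] = adj H, while det(Hhat) Hhat^-1 = adj Hhat almost surely.
   The s_i themselves are integrable: on the event that all |s_j|, j != i, are
   bounded, which has positive probability and is independent of s_i, a nonzero
   entry of Hhat controls |s_i|. *)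

(** * Multi-affine expansions for combinations of matrices of rank at most one *)

Lemma rank_le1_outer (F : fieldType) (m n : nat) (A : 'M[F]_(m, n)) :
  (\rank A <= 1)%N -> exists u : 'I_m -> F, exists v : 'I_n -> F,
    forall i j, A i j = u i * v j.
Proof.
move=> rA; case: (posnP (\rank A)) => [/eqP|r0].
  rewrite mxrank_eq0 => /eqP ->; exists (fun=> 0), (fun=> 0) => i j.
  by rewrite mxE mul0r.
(* [mulmx_base] factors [A] through inner dimension [\rank A], which is now exactly one, so each
   entry of the product is the single term at [o]. *)
pose o := Ordinal r0.
exists (fun i => col_base A i o), (fun j => row_base A o j) => i j.
rewrite -[in LHS](mulmx_base A) mxE (bigD1 o)//= big1 ?addr0// => r /negP[].
by apply/eqP/val_inj/eqP; rewrite /= -leqn0 -ltnS (leq_trans (ltn_ord r)).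
Qed.

(** Row [k] of the sum is a combination of the rows [v i] with coefficients [x i * u i k].
    Multilinearity expands the determinant over the choices [f] of one index per row, and a choice
    that repeats an index gives two equal rows. *)
Lemma det_sum_rank1 (F : fieldType) (n : nat) (I : finType)
    (Z : I -> 'M[F]_n) : (forall i, (\rank (Z i) <= 1)%N) ->
  exists c : {ffun 'I_n -> I} -> F, forall x : I -> F,
    \det (\sum_i x i *: Z i) =
      \sum_(f : {ffun 'I_n -> I} | injectiveb f) c f * \prod_k x (f k).
Proof.
move=> /(_ _)/rank_le1_outer-/fin_all_exists[u]/fin_all_exists[v] Zuv.
pose V (f : {ffun 'I_n -> I}) := \matrix_(k, j) v (f k) j.
exists (fun f : {ffun 'I_n -> I} => (\prod_k u (f k) k) * \det (V f)) => x.
have detE (s : 'S_n) : \prod_i (\sum_l x l *: Z l) i (s i) =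
    \sum_(f : {ffun 'I_n -> I})
      (\prod_k u (f k) k) * (\prod_k V f k (s k)) * \prod_k x (f k).
  under eq_bigr do rewrite summxE.
  rewrite bigA_distr_bigA/=; apply: eq_bigr => f _.
  rewrite -!big_split/=; apply: eq_bigr => k _.
  by rewrite !mxE Zuv mulrC.
rewrite {1}/determinant; under eq_bigr do rewrite detE big_distrr/=.
rewrite exchange_big/= (bigID (fun f : {ffun 'I_n -> I} => injectiveb f))/=.
rewrite [X in _ + X]big1 ?addr0.
  apply: eq_bigr => f _; rewrite /determinant big_distrr big_distrl/=.
  by apply: eq_bigr => s _; rewrite !mulrA; congr (_ * _ * _); rewrite mulrC.
move=> f /injectivePn[k1 [k2 k12 fk]].
(* The sum over permutations reassembles into [\det (V f)], where rows [k1] and [k2] coincide. *)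
transitivity ((\prod_k u (f k) k) * \det (V f) * \prod_k x (f k)).
  rewrite /determinant big_distrr big_distrl/=.
  by apply: eq_bigr => s _; rewrite !mulrA; congr (_ * _ * _); rewrite mulrC.
rewrite (determinant_alternate k12) ?mulr0 ?mul0r// => j.
by rewrite !mxE fk.
Qed.

(** Deleting a row and a column is linear and does not raise the rank, so the minor falls under
    [det_sum_rank1]; the sign goes into the coefficients. *)
Lemma cofactor_sum_rank1 (F : fieldType) (n : nat) (I : finType)
    (Z : I -> 'M[F]_n) (i j : 'I_n) : (forall i, (\rank (Z i) <= 1)%N) ->
  exists c : {ffun 'I_n.-1 -> I} -> F, forall x : I -> F,
    cofactor (\sum_i x i *: Z i) i j =
      \sum_(f : {ffun 'I_n.-1 -> I} | injectiveb f) c f * \prod_k x (f k).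
Proof.
move=> rZ; have rZ' l : (\rank (row' i (col' j (Z l))) <= 1)%N.
  apply: leq_trans (rZ l); apply: leq_trans (_ : \rank (col' j (Z l)) <= _)%N.
    by rewrite row'Esub; apply/mxrankS/rowsub_sub.
  rewrite -mxrank_tr tr_col' -(mxrank_tr (Z l)) row'Esub.
  exact/mxrankS/rowsub_sub.
have [c cE] := det_sum_rank1 rZ'.
exists (fun f : {ffun 'I_n.-1 -> I} => (-1) ^+ (i + j) * c f) => x.
rewrite /cofactor.
have -> : row' i (col' j (\sum_l x l *: Z l)) =
    \sum_l x l *: row' i (col' j (Z l)).
  by apply/matrixP => a b; rewrite !mxE !summxE; apply: eq_bigr => l _;
    rewrite !mxE.
by rewrite cE big_distrr/=; apply: eq_bigr => f _; rewrite mulrA.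
Qed.

(** * Integral factorization, coordinatewise induction and tightness *)

Section factor.
Import HBNNSimple.

(** The hypothesis on indicators passes to simple functions by linearity, then to nonnegative
    measurable [h] by monotone convergence. In the applications [g] is built from the variables
    other than [X], and [c] is the product of the corresponding means. *)
Lemma ge0_integral_mul_factor (d d' : measure_display) (T : measurableType d)
    (T' : measurableType d') (R : realType) (P : probability T R)
    (X : {RV P >-> T'}) (g : T -> R) (c : R) :
  measurable_fun setT g -> (forall w, 0 <= g w) -> 0 <= c ->
  (forall B, measurable B ->
    (\int[P]_w (g w * \1_B (X w))%:E = c%:E * P (X @^-1` B))%E) ->
  forall h : T' -> R, measurable_fun setT h -> (forall x, 0 <= h x) ->
  (\int[P]_w (g w * h (X w))%:E = c%:E * \int[P]_w (h (X w))%:E)%E.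
Proof.
move=> mg g0 c0 gB h mh h0.
have mX : measurable_fun setT X by [].
have mhE : measurable_fun setT (EFin \o h) by exact/measurable_EFinP.
pose a := nnsfun_approx measurableT mhE.
have simple (k : {nnsfun T' >-> R}) :
    (\int[P]_w (g w * k (X w))%:E = c%:E * \int[P]_w (k (X w))%:E)%E.
  have kE x : k x = \sum_(r \in range k) (r * \1_(k @^-1` [set r]) x) :> R.
    exact: fimfunE.
  have m1 r : measurable_fun setT (fun w => \1_(k @^-1` [set r]) (X w) : R).
    by apply: (measurableT_comp (measurable_indic _) mX).
  have t0 r x : 0 <= r * \1_(k @^-1` [set r]) x.
    rewrite indicE; case: (boolP (x \in _)) => [|_]; last by rewrite mulr0.
    by rewrite inE/= => <-; rewrite mulr1.
  transitivity (\int[P]_w \sum_(r \in range k)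
      (r * (g w * \1_(k @^-1` [set r]) (X w)))%:E)%E.
    apply: eq_integral => w _; rewrite fsumEFin// kE; congr (_%:E).
    rewrite !fsbig_finite//= mulr_sumr; apply: eq_bigr => r _.
    by rewrite mulrCA.
  rewrite ge0_integral_fsum//; last 2 first.
  - move=> r; apply/measurable_EFinP; apply: measurable_funM => //.
    exact: measurable_funM.
  - by move=> r w _; rewrite lee_fin mulrCA mulr_ge0.
  transitivity (c%:E * \int[P]_w \sum_(r \in range k)
      (r * \1_(k @^-1` [set r]) (X w))%:E)%E; last first.
    by congr (_ * _)%E; apply: eq_integral => w _; rewrite fsumEFin// -kE.
  rewrite ge0_integral_fsum//; last 2 first.
  - by move=> r; apply/measurable_EFinP; apply: measurable_funM.
  - by move=> r w _; rewrite lee_fin.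
  rewrite ge0_mule_fsumr; last first.
    by move=> r; apply: integral_ge0 => w _; rewrite lee_fin.
  apply: eq_fsbigr => r _.
  (* Pulling [r] out of the integrals requires [0 <= r]; since [k] is nonnegative, a negative value
     has an empty level set. *)
  have [r0|r0] := ltP r 0.
    have -> : k @^-1` [set r] = set0.
      apply/seteqP; split => // x /= kx.
      by move: r0; rewrite -kx ltNge fun_ge0.
    rewrite !integral0_eq ?mule0// => w _; rewrite indic0 !mulr0//.
  under eq_integral do rewrite EFinM.
  under [in RHS]eq_integral do rewrite EFinM.
  have mB : measurable (k @^-1` [set r]) by [].
  rewrite ge0_integralZl_EFin//; last 2 first.
  - by move=> w _; rewrite lee_fin mulr_ge0.
  - by apply/measurable_EFinP; apply: measurable_funM.
  rewrite ge0_integralZl_EFin//; last by apply/measurable_EFinP.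
  rewrite gB// muleCA; congr (_ * (_ * _))%E.
  transitivity (\int[P]_w (\1_(X @^-1` (k @^-1` [set r])) w)%:E)%E; last first.
    by apply: eq_integral => w _; rewrite !indicE.
  by rewrite integral_indic ?setIT//; exact: (measurable_funPTI X mB).
have cvga x : EFin \o a^~ x @ \oo --> (h x)%:E.
  by apply: (cvg_nnsfun_approx measurableT mhE) => // y _; rewrite lee_fin.
have nda x m n : (m <= n)%N -> a m x <= a n x.
  by move=> mn; exact/lefP/(nd_nnsfun_approx measurableT mhE).
have maX n : measurable_fun setT (fun w => a n (X w)).
  exact: measurableT_comp.
transitivity (limn (fun n => \int[P]_w (g w * a n (X w))%:E)%E).
  rewrite -monotone_convergence//; last 3 first.
  - by move=> n; apply/measurable_EFinP; exact: measurable_funM.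
  - by move=> n w _; rewrite lee_fin mulr_ge0.
  - by move=> w _ m n mn; rewrite lee_fin ler_wpM2l// nda.
  apply: eq_integral => w _; apply/esym/cvg_lim => //.
  under eq_fun do rewrite EFinM.
  by rewrite EFinM; apply: cvgeZl => //; exact: cvga.
under eq_fun do rewrite simple.
rewrite limeMl//; last first.
  apply: ereal_nondecreasing_is_cvgn => m n mn; apply: ge0_le_integral => //.
  - by move=> w _; rewrite lee_fin.
  - exact/measurable_EFinP.
  - exact/measurable_EFinP.
  - by move=> w _; rewrite lee_fin nda.
congr (_ * _)%E; rewrite -monotone_convergence//; last 3 first.
- by move=> n; exact/measurable_EFinP.
- by move=> n w _; rewrite lee_fin.
- by move=> w _ m n mn; rewrite lee_fin nda.
by apply: eq_integral => w _; apply/cvg_lim => //; exact: cvga.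
Qed.

End factor.

(** Serves to widen the class of admissible factors one coordinate at a time: first from indicators
    to nonnegative functions, then to integrable ones. *)
Lemma one_coordinate_ind (I : finType) (A : Type) (C C' : I -> A -> Prop)
    (Q : (I -> A) -> Prop) :
  (forall i a, C i a -> C' i a) ->
  (forall h, (forall i, C i (h i)) -> Q h) ->
  (forall i h, (forall j, C' j (h j)) ->
    (forall a, C i a -> Q (fun j => if j == i then a else h j)) -> Q h) ->
  forall h, (forall i, C' i (h i)) -> Q h.
Proof.
move=> CC' QC step h C'h.
(* The induction is on a list outside of which [C] is known to hold; for [enum I] this is vacuous,
   and for the empty list [QC] applies. *)
have : forall i, i \notin enum I -> C i (h i).
  by move=> i; rewrite mem_enum.
elim: (enum I) h C'h => [|i l IH] h C'h Ch; first by apply: QC => i; exact: Ch.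
apply: (step i) => // a Ca; apply: IH => j; have [->|ji] := eqVneq j i => //.
  exact: CC'.
by move=> jl; apply: Ch; rewrite inE negb_or ji.
Qed.

(** Otherwise the whole space would be a countable union of null events. *)
Lemma RV_tight (d : measure_display) (T : measurableType d) (R : realType)
    (P : probability T R) (X : {RV P >-> R}) :
  exists M : R, 0 < fine (P (X @^-1` `[- M, M])).
Proof.
apply: contrapT => /forallNP H.
have mX (M : R) : measurable (X @^-1` `[- M, M]).
  exact: measurable_funPTI.
have P0 (M : R) : P (X @^-1` `[- M, M]) = 0%E.
  apply/eqP; rewrite eq_le measure_ge0 andbT leNgt; apply/negP => PM.
  apply: (H M); rewrite fine_gt0// PM/= ltey_eq fin_num_measure//.
have : P.-negligible (\bigcup_(k : nat) (X @^-1` `[- k%:R, k%:R])).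
  apply: negligible_bigcup => k.
  by exists (X @^-1` `[- k%:R, k%:R]); split => //; exact: P0.
rewrite (_ : bigcup _ _ = setT); last first.
  apply/seteqP; split => // w _; exists (Num.truncn `|X w|).+1 => //=.
  by rewrite in_itv/= -ler_norml ltW// truncnS_gt.
move=> /(measure_negligible measurableT) PT; have := @probability_setT _ _ _ P.
rewrite PT => /eqP.
by rewrite eq_sym onee_eq0.
Qed.

(** * Expectations of products of independent variables *)

Section independence.
Context (d : measure_display) (T : measurableType d) (R : realType)
  (P : probability T R) (I : finType) (s : I -> {RV P >-> R})
  (s_indep : mutually_independent s).

Lemma integral_prod_indic (B : I -> set R) : (forall i, measurable (B i)) ->
  (\int[P]_w (\prod_i \1_(B i) (s i w))%:E =
    (\prod_i fine (P (s i @^-1` B i)))%:E)%E.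
Proof.
move=> mB.
have mS i : measurable (s i @^-1` B i).
  exact: measurable_funPTI.
transitivity (P (\bigcap_(i in [set` [set: I]%SET]) (s i @^-1` B i))).
  rewrite -[in RHS](setIT (\bigcap_(_ in _) _)) -integral_indic//; last first.
    by apply: fin_bigcap_measurable => //; exact: finite_finset.
  apply: eq_integral => w _; congr (_%:E).
  rewrite [RHS]indicE; case: (boolP (w \in _)) => [|]; rewrite ?inE/= => Bw.
    rewrite big1// => i _; rewrite indicE mem_set//.
    exact: (Bw i (finset.in_setT i)).
  have [i Bi] : exists i, ~ B i (s i w).
    apply: contrapT => /forallNP nB; case/negP: Bw.
    by rewrite inE /bigcap/= => i _; exact: contrapT.
  by rewrite (bigD1 i)//= indicE memNset// mul0r.
rewrite s_indep// -prodEFin.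
apply: eq_big => [i|i _]; first by rewrite finset.in_setT.
by rewrite fineK// fin_num_measure.
Qed.

Definition mean (i : I) (u : R -> R) : R := fine (\int[P]_w (u (s i w))%:E)%E.

(** Integrability is carried along because the passage to signed factors subtracts two such
    integrals. *)
Definition prod_rule (h : I -> R -> R) :=
  P.-integrable setT (fun w => (\prod_i h i (s i w))%:E) /\
  (\int[P]_w (\prod_i h i (s i w))%:E = (\prod_i mean i (h i))%:E)%E.

Let ok i (u : R -> R) :=
  measurable_fun setT u /\ P.-integrable setT (fun w => (u (s i w))%:E).
Let ge0_ok i (u : R -> R) := ok i u /\ forall x, 0 <= u x.
Let indic (i : I) (u : R -> R) := exists2 B, measurable B & u = \1_B.

Let mean_indic i B : measurable B -> mean i \1_B = fine (P (s i @^-1` B)).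
Proof.
move=> mB; congr fine.
have mS : measurable (s i @^-1` B).
  exact: measurable_funPTI.
by rewrite -(setIT (_ @^-1` _)) -integral_indic.
Qed.

Let measurable_comp_s i (u : R -> R) : measurable_fun setT u ->
  measurable_fun setT (fun w => u (s i w)).
Proof. by move=> mu; exact: measurableT_comp. Qed.

Let integrable_bounded (u : T -> R) : measurable_fun setT u ->
  (forall w, `|u w| <= 1) -> P.-integrable setT (fun w => (u w)%:E).
Proof.
move=> mu u1.
have := finite_measure_integrable_cst P 1 measurableT.
apply: le_integrable => //; first exact/measurable_EFinP.
by move=> w _; rewrite /= lee_fin normr1.
Qed.

Let indic_ok i u : indic i u -> ge0_ok i u.
Proof.
case=> B mB ->; split; last by move=> x; rewrite indicE.
have m1 : measurable_fun setT (\1_B : R -> R) by [].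
split=> //; apply: integrable_bounded; first exact: measurable_comp_s.
by move=> w; rewrite indicE ger0_norm//; case: (_ \in _).
Qed.

Lemma prod_rule_indic h : (forall i, indic i (h i)) -> prod_rule h.
Proof.
move=> /[dup] hi /(_ _)/cid2-/all_sig2[B mB hB]; split.
  apply: integrable_bounded.
    apply: measurable_prod => i _; apply: measurable_comp_s.
    by case: (indic_ok (hi i)) => -[].
  move=> w; rewrite normr_prod; apply: prodr_ile1 => i _.
  by rewrite normr_ge0/= hB indicE ger0_norm//; case: (_ \in _).
under eq_integral do under eq_bigr do rewrite hB.
rewrite integral_prod_indic//; congr (_%:E).
by apply: eq_bigr => i _; rewrite hB mean_indic.
Qed.

(** With the factors other than the [i]-th held fixed, the rule for an indicator in place [i] is
    exactly the premise of [ge0_integral_mul_factor]. *)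
Lemma prod_rule_ge0 h : (forall i, ge0_ok i (h i)) -> prod_rule h.
Proof.
apply: (one_coordinate_ind indic_ok prod_rule_indic) => i {}h hok step.
have mg : measurable_fun setT (fun w => \prod_(j | j != i) h j (s j w)).
  under eq_fun do rewrite -big_filter.
  apply: measurable_prod => j _; apply: measurable_comp_s.
  by case: (hok j) => -[].
(* [F] stands for either of the two products in play: that of the values at a point and that of the
   means. *)
have bigi a (F : (R -> R) -> I -> R) :
    \prod_j F (if j == i then a else h j) j =
    (\prod_(j | j != i) F (h j) j) * F a i.
  rewrite (bigD1 i)//= eqxx mulrC; congr (_ * _).
  by apply: eq_bigr => j /negbTE ->.
have bigi0 (F : (R -> R) -> I -> R) :
    \prod_j F (h j) j = (\prod_(j | j != i) F (h j) j) * F (h i) i.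
  by rewrite (bigD1 i)//= mulrC.
have mean_ge0 j : 0 <= mean j (h j).
  apply: fine_ge0; apply: integral_ge0 => w _; rewrite lee_fin.
  by case: (hok j).
have [[mhi ihi] hi0] := hok i.
have E : (\int[P]_w (\prod_j h j (s j w))%:E = (\prod_j mean j (h j))%:E)%E.
  under eq_integral do rewrite (bigi0 (fun u j => u (s j _))).
  rewrite (bigi0 (fun u j => mean j u)).
  rewrite (@ge0_integral_mul_factor _ _ _ _ _ _ _ _
    (\prod_(j | j != i) mean j (h j)))//.
  - by rewrite EFinM /mean fineK// integrable_fin_num.
  - by move=> w; apply: prodr_ge0 => j _; case: (hok j).
  - exact: prodr_ge0.
  - move=> B mB; have [_] := step _ (ex_intro2 _ _ B mB erefl).
    under eq_integral do rewrite (bigi _ (fun u j => u (s j _))).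
    move=> ->; rewrite (bigi _ (fun u j => mean j u)).
    rewrite mean_indic// EFinM fineK//.
    by rewrite fin_num_measure//; exact: measurable_funPTI.
split=> //; apply/integrableP; split.
  apply/measurable_EFinP; apply: measurable_prod => j _.
  by apply: measurable_comp_s; case: (hok j) => -[].
under eq_integral => w _.
  rewrite gee0_abs; last by rewrite lee_fin; apply: prodr_ge0 => j _;
    case: (hok j).
  over.
by rewrite E ltry.
Qed.

Let ge0_okW i u : ge0_ok i u -> ok i u. Proof. by case. Qed.

(** Both sides are additive in the [i]-th factor, so the rule follows from those for its positive
    and negative parts. *)
Lemma prod_rule_integrable h : (forall i, ok i (h i)) -> prod_rule h.
Proof.
apply: (one_coordinate_ind ge0_okW prod_rule_ge0) => i {}h hok step.
have [mhi ihi] := hok i.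
have okp : ge0_ok i (h i)^\+.
  split; last by move=> x; rewrite /funrpos le_max lexx orbT.
  split; first exact: measurable_funrpos.
  rewrite /= (_ : (fun _ => _) = fun w => ((h i \o s i)^\+ w)%:E)//.
  exact: integrable_funrpos.
have okn : ge0_ok i (h i)^\-.
  split; last by move=> x; rewrite /funrneg le_max lexx orbT.
  split; first exact: measurable_funrneg.
  rewrite /= (_ : (fun _ => _) = fun w => ((h i \o s i)^\- w)%:E)//.
  exact: integrable_funrneg.
have [ip Ep] := step _ okp; have [iN EN] := step _ okn.
pose hp j := if j == i then (h i)^\+ else h j.
pose hn j := if j == i then (h i)^\- else h j.
have bigi (F : I -> (R -> R) -> R) :
  F i (h i) = F i ((h i)^\+) - F i ((h i)^\-) ->
  \prod_j F j (h j) = \prod_j F j (hp j) - \prod_j F j (hn j).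
  move=> Fi.
  rewrite (bigD1 i)//= [X in _ = X - _](bigD1 i)//=.
  rewrite [X in _ = _ - X](bigD1 i)//=.
  rewrite /hp /hn eqxx Fi mulrBl; congr (_ * _ - _ * _);
  by apply: eq_bigr => j /negbTE ->.
have hpn x : h i x = (h i)^\+ x - (h i)^\- x.
  by rewrite -{1}(funrposBneg (h i)).
have prodE w : (\prod_j h j (s j w))%:E =
    ((\prod_j hp j (s j w))%:E - (\prod_j hn j (s j w))%:E)%E.
  by rewrite -EFinB (bigi (fun j u => u (s j w))).
split.
  by under eq_fun do rewrite prodE; exact: integrableB.
under eq_integral do rewrite prodE.
rewrite integralB// Ep EN -EFinB; congr (_%:E); apply/esym/bigi.
rewrite /mean -fineB ?integrable_fin_num//;
  [|by case: okp => -[]|by case: okn => -[]].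
rewrite -integralB//; [|by case: okp => -[]|by case: okn => -[]].
by congr fine; apply: eq_integral => w _; rewrite hpn EFinB.
Qed.

Lemma integrable_summand (a : I -> R) (i : I) : a i != 0 ->
  P.-integrable setT (fun w => (\sum_j a j * s j w)%:E) ->
  P.-integrable setT (fun w => (s i w)%:E).
Proof.
move=> ai0 iS; have /choice[M MP] := fun j => RV_tight (s j).
pose g w := \prod_(j | j != i) \1_(`[- M j, M j]%classic) (s j w) : R.
pose c := \prod_(j | j != i) fine (P (s j @^-1` `[- M j, M j])).
have c0 : 0 < c by exact: prodr_gt0.
have g01 w : 0 <= g w <= 1.
  rewrite /g prodr_ge0//=; apply: prodr_ile1 => j _.
  by rewrite indicE ler0n lern1; case: (_ \in _).
have mg : measurable_fun setT g.
  rewrite /g; under eq_fun do rewrite -big_filter.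
  apply: measurable_prod => j _.
  exact: (measurableT_comp (measurable_indic _)).
have gB (B : set R) : measurable B ->
    (\int[P]_w (g w * \1_B (s i w))%:E = c%:E * P (s i @^-1` B))%E.
  (* With [B] in place [i] and the truncation intervals elsewhere, [integral_prod_indic] gives the
     factorization. *)
  move=> mB; pose B' j := if j == i then B else `[- M j, M j]%classic.
  have mB' j : measurable (B' j) by rewrite /B'; case: ifP.
  have B'i : B' i = B by rewrite /B' eqxx.
  have := integral_prod_indic mB'.
  under eq_integral do rewrite (bigD1 i)//= B'i.
  rewrite (bigD1 i)//= B'i EFinM fineK; last first.
    by rewrite fin_num_measure//; exact: measurable_funPTI.
  rewrite muleC => E.
  have -> : c = \prod_(j | j != i) fine (P (s j @^-1` B' j)).
    by apply: eq_bigr => j /negbTE; rewrite /B' => ->.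
  rewrite -E; apply: eq_integral => w _; rewrite mulrC; congr ((_ * _)%:E).
  by apply: eq_bigr => j /negbTE; rewrite /B' => ->.
have mnorm : measurable_fun [set: R] (fun x : R => `|x|).
  exact: measurableT_comp.
have Eg := ge0_integral_mul_factor mg (fun w => proj1 (andP (g01 w))) (ltW c0)
  gB mnorm (@normr_ge0 _ _).
(* Where [g] is nonzero, [b] bounds the sum of the terms with [j != i]. Taking absolute values of
   [M j] avoids a sign argument. *)
pose b := \sum_(j | j != i) `|a j| * `|M j|.
have bound w : g w * `|s i w| <= `|a i|^-1 * (`|\sum_j a j * s j w| + b).
  have gi w0 : 0 <= g w0 by case/andP: (g01 w0).
  rewrite mulrC ler_pdivlMl ?normr_gt0// mulrA -normrM.
  have -> : a i * s i w = (\sum_j a j * s j w) - \sum_(j | j != i) a j * s j w.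
    by rewrite (bigD1 i)//= addrK.
  have [w1|] := pselect (forall j, j != i -> `|s j w| <= M j).
    apply: (@le_trans _ _
      (`|\sum_j a j * s j w| + `|\sum_(j | j != i) a j * s j w|)).
      rewrite -[leRHS]mulr1 ler_pM ?ler_normB//.
      by case/andP: (g01 w).
    rewrite lerD2l; apply: le_trans (ler_norm_sum _ _ _) _.
    apply: ler_sum => j ji; rewrite normrM ler_wpM2l//.
    exact: le_trans (w1 _ ji) (ler_norm _).
  move=> /existsNP[j /not_implyP[ji sj]].
  have -> : g w = 0.
    rewrite /g (bigD1 j)//= indicE memNset ?mul0r//= in_itv/= -ler_norml.
    exact: sj.
  by rewrite mulr0 addr_ge0// sumr_ge0// => k _; exact: mulr_ge0.
have ib : P.-integrable setT
    (fun w => (`|a i|^-1 * (`|\sum_j a j * s j w| + b))%:E).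
  under eq_fun do rewrite EFinM.
  apply: integrableZl => //; under eq_fun do rewrite EFinD.
  apply: integrableD => //; first exact: (integrable_abse iS).
  exact: finite_measure_integrable_cst.
apply/integrableP; split; first exact/measurable_EFinP.
(* If the mean of [|s i|] were infinite, so would be that of [g * |s i|], as [c > 0]; but [bound]
   makes the latter finite. *)
rewrite ltey; apply/eqP => soo.
move: Eg; rewrite [X in (_ = _ * X)%E]soo gt0_muley ?lte_fin// => goo.
have : (\int[P]_w (g w * `|s i w|)%:E < +oo)%E.
  have msi : measurable_fun setT (fun w => `|s i w|) by exact: measurableT_comp.
  have /integrableP[_] : P.-integrable setT (fun w => (g w * `|s i w|)%:E).
    apply: le_integrable ib => //.
      by apply/measurable_EFinP; exact: measurable_funM.
    move=> w _; have /andP[gw _] := g01 w.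
    rewrite lee_fin ger0_norm ?mulr_ge0//.
    exact: le_trans (bound w) (ler_norm _).
  apply: le_lt_trans; apply: ge0_le_integral => //.
  - by move=> w _; have /andP[gw _] := g01 w; rewrite lee_fin mulr_ge0.
  - by apply/measurable_EFinP; exact: measurable_funM.
  - by do 2 apply: measurableT_comp => //; exact: measurable_funM.
  - by move=> w _; rewrite lee_fin ler_norm.
by rewrite goo.
Qed.

(** Injectivity makes each variable occur at most once, so [prod_rule_integrable] applies with the
    identity on the image of [f] and the constant 1 elsewhere. *)
Lemma integral_prod_inj (n : nat) (f : 'I_n -> I) : injective f ->
  (forall i, P.-integrable setT (fun w => (s i w)%:E)) ->
  P.-integrable setT (fun w => (\prod_k s (f k) w)%:E) /\
  (\int[P]_w (\prod_k s (f k) w)%:E =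
    (\prod_k fine (\int[P]_w (s (f k) w)%:E))%:E)%E.
Proof.
move=> finj is_.
pose h i : R -> R := if i \in [set f k | k : 'I_n]%SET then id else cst 1.
have hE (F : I -> (R -> R) -> R) : (forall i, F i (cst 1) = 1) ->
    \prod_i F i (h i) = \prod_k F (f k) id.
  move=> F1; rewrite (bigID (fun i => i \in [set f k | k : 'I_n]%SET))/=.
  rewrite [X in _ * X]big1 ?mulr1; last first.
    by move=> i fi; rewrite /h (negbTE fi).
  rewrite big_imset/=; last by move=> ? ? _ _; exact: finj.
  by apply: eq_bigr => k _; rewrite /h imset_f.
have mean1 i : mean i (cst 1) = 1.
  rewrite /mean [X in fine X](integral_cst P measurableT 1%E).
  by rewrite [X in (_ * X)%E](@probability_setT _ _ _ P) mul1e.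
have [i|ih Eh] := prod_rule_integrable (h := h).
  rewrite /h; case: ifP => _; split => //.
  exact: finite_measure_integrable_cst.
split.
  apply: eq_integrable ih => // w _; congr (_%:E).
  exact: (hE (fun j u => u (s j w))).
transitivity (\int[P]_w (\prod_i h i (s i w))%:E)%E.
  by apply: eq_integral => w _; rewrite (hE (fun j u => u (s j w))).
by rewrite Eh (hE (fun j u => mean j u)).
Qed.

Lemma integral_multiaffine (n : nat) (c : {ffun 'I_n -> I} -> R)
    (F : (I -> R) -> R) :
  (forall i, P.-integrable setT (fun w => (s i w)%:E)) ->
  (forall x, F x =
    \sum_(f : {ffun 'I_n -> I} | injectiveb f) c f * \prod_k x (f k)) ->
  P.-integrable setT (fun w => (F (s ^~ w))%:E) /\
  (\int[P]_w (F (s ^~ w))%:E = (F (fun i => fine (\int[P]_w (s i w)%:E)))%:E)%E.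
Proof.
move=> is_ FE.
(* The library's [integral_sum] asks every summand to be integrable, also those
   filtered out: put the filter into the coefficient. *)
pose c' (f : {ffun 'I_n -> I}) := if injectiveb f then c f else 0.
have F'E x : F x = \sum_(f : {ffun 'I_n -> I}) c' f * \prod_k x (f k).
  rewrite FE big_mkcond/=; apply: eq_bigr => f _.
  by rewrite /c'; case: ifP => // _; rewrite mul0r.
pose t (f : {ffun 'I_n -> I}) w := (c' f * \prod_k s (f k) w)%:E.
have tP f : P.-integrable setT (t f) /\ (\int[P]_w t f w =
    (c' f * \prod_k fine (\int[P]_w (s (f k) w)%:E))%:E)%E.
  rewrite /t /c'; case: ifPn => [/injectiveP finj|_].
    have [iprod Eprod] := integral_prod_inj finj is_.
    under eq_fun do rewrite EFinM.
    split; first exact: integrableZl.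
    by rewrite integralZl// Eprod EFinM.
  under eq_fun do rewrite mul0r.
  by rewrite mul0r integral0; split => //; exact: integrable0.
have E w : (F (s ^~ w))%:E = (\sum_f t f w)%E by rewrite F'E sumEFin.
split.
  under eq_fun do rewrite E.
  by apply: integrable_sum => // f _; have [] := tP f.
under eq_integral do rewrite E.
rewrite integral_sum//; last by move=> f; have [] := tP f.
by rewrite F'E -sumEFin; apply: eq_bigr => f _; have [] := tP f.
Qed.

End independence.

(** * The inverse of the mean matrix *)

Theorem theorem1 (d : measure_display) (T : measurableType d) (R : realType)
    (P : probability T R) (I : finType) (n : nat)
    (s : I -> {RV P >-> R}) (Z : I -> 'M[R]_n)
    (s_indep : mutually_independent s)
    (Z_rank1 : forall i, \rank (Z i) = 1%N)
    (H_exists : mx_integrable P (random_sum_mx s Z))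
    (Hhat_inv : {ae P, forall w, random_sum_mx s Z w \in unitmx})
    (H_inv : mx_expectation P (random_sum_mx s Z) \in unitmx) :
  let Hhat := random_sum_mx s Z in
  let H := mx_expectation P Hhat in
  let detHhat := fun w => \det (Hhat w) in
  let detHhat_inv := fun w => \det (Hhat w) *: invmx (Hhat w) in
  [/\ P.-integrable [set: T] (fun w => (detHhat w)%:E),
      mx_integrable P detHhat_inv,
      fine ('E_P[detHhat])%E != 0 &
      invmx H = (fine ('E_P[detHhat])%E)^-1 *: mx_expectation P detHhat_inv].
Proof.
move=> Hhat H detHhat detHhat_inv.
have Hhat_entry w a b : Hhat w a b = \sum_i Z i a b * s i w.
  rewrite /Hhat /random_sum_mx summxE; apply: eq_bigr => i _.
  by rewrite mxE mulrC.
have is_ i : P.-integrable setT (fun w => (s i w)%:E).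
  (* A nonzero entry of [Z i] makes [s i] occur with nonzero coefficient in the integrable entry
     [(a, b)] of [Hhat]. *)
  have [a [b Zab]] : exists a b, Z i a b != 0.
    apply: contrapT => Z0; have := Z_rank1 i.
    suff -> : Z i = 0 by rewrite mxrank0.
    apply/matrixP => a b; rewrite mxE; apply/eqP/negPn/negP => Zab.
    by apply: Z0; exists a, b.
  apply: (integrable_summand s_indep (a := fun j => Z j a b) Zab).
  by apply: eq_integrable (H_exists a b) => // w _; rewrite Hhat_entry.
pose m i := fine (\int[P]_w (s i w)%:E)%E.
have HE : H = \sum_i m i *: Z i.
  apply/matrixP => a b; rewrite mxE unlock summxE.
  under eq_integral => w _ do rewrite Hhat_entry -sumEFin.
  under eq_integral => w _ do under eq_bigr => i _ do rewrite EFinM.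
  rewrite integral_sum//; last by move=> i; exact: integrableZl.
  under eq_bigr do
    rewrite integralZl// -(fineK (integrable_fin_num measurableT (is_ _)))
      -EFinM.
  by rewrite sumEFin/=; apply: eq_bigr => i _; rewrite mxE mulrC.
have Zle1 i : (\rank (Z i) <= 1)%N by rewrite Z_rank1.
have [cd cdE] := det_sum_rank1 Zle1.
have [idet Edet] := integral_multiaffine s_indep is_ cdE.
have detE : fine 'E_P[detHhat] = \det H by rewrite unlock HE Edet.
have H0 : \det H != 0 by rewrite -unitfE -unitmxE.
have cofE w i j : Hhat w \in unitmx ->
    detHhat_inv w i j = cofactor (Hhat w) j i.
  move=> Hw; rewrite /detHhat_inv /invmx Hw scalerA divff; last first.
    by rewrite -unitfE -unitmxE.
  by rewrite scale1r mxE.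
have ae_cof i j : {ae P, forall w, [set: T] w ->
    (detHhat_inv w i j)%:E = (cofactor (Hhat w) j i)%:E}.
  by apply: filterS Hhat_inv => w Hw _; rewrite cofE.
have cofP i j : P.-integrable setT (fun w => (cofactor (Hhat w) j i)%:E) /\
    (\int[P]_w (cofactor (Hhat w) j i)%:E = (cofactor H j i)%:E)%E.
  have [c cE] := cofactor_sum_rank1 j i Zle1.
  by have := integral_multiaffine s_indep is_ cE; rewrite -HE.
(* Almost sure equality with a cofactor does not by itself give measurability, since [P] need not be
   complete; hence an identity valid at every [w]. *)
have iinv : mx_integrable P detHhat_inv.
  move=> i j; have [icof _] := cofP i j.
  (* invmx A = A when A is singular, but then the factor \det A vanishes. *)
  have invE w : detHhat_inv w i j =
      \1_(~` [set 0]) (detHhat w) * cofactor (Hhat w) j i.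
    rewrite indicE; have [d0|d0] := eqVneq (detHhat w) 0.
      rewrite memNset ?mul0r; last by move=> /(_ d0).
      by rewrite /detHhat_inv -/(detHhat w) d0 scale0r mxE.
    by rewrite mem_set ?mul1r ?cofE// ?unitmxE ?unitfE//; exact/eqP.
  have mcof : measurable_fun setT (fun w => cofactor (Hhat w) j i).
    by apply/measurable_EFinP; exact: measurable_int icof.
  have mdet : measurable_fun setT detHhat.
    by apply/measurable_EFinP; exact: measurable_int idet.
  apply: le_integrable icof => //.
    apply/measurable_EFinP; under eq_fun do rewrite invE.
    apply: measurable_funM => //.
    apply: (measurableT_comp (measurable_indic _)) => //.
    exact: measurableC.
  move=> w _; rewrite lee_fin invE normrM indicE.
  by case: (_ \in _); rewrite ?normr1 ?mul1r// normr0 mul0r.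
split=> //; first by rewrite detE.
(* For invertible [H], [invmx H] unfolds to [(\det H)^-1 *: \adj H], so it remains to compare
   [\adj H] entrywise with the expected cofactors. *)
rewrite detE /invmx H_inv; congr (_ *: _); apply/matrixP => i j.
have [icof Ecof] := cofP i j.
rewrite !mxE unlock (_ : (\int[P]_w _)%E = (cofactor H j i)%:E)// -Ecof.
apply: ae_eq_integral => //; last exact: ae_cof.
- exact: measurable_int (iinv i j).
- exact: measurable_int icof.
Qed.
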